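(* Assume values are i.i.d. on $[0,\bar v]$ with CDF $F$ and density $f>0$, and $1 \le k < n$. Let $A$ be the efficient allocation rule. Let $v_{(k+1)}$ denote the $(k+1)$-st highest value, and define $b(0) = 0$ and, for $v > 0$, $b(v) = \mathbb E[v_{(k+1)} \mid v_i = v, A_i(\bm v) = 1]$. Define $R^D(\bm v) = \sum_{i=1}^n A_i(\bm v)\,b(v_i)$ (revenue of the discriminatory winner-pays-bid auction in its symmetric strictly increasing equilibrium) and $R^U(\bm v) = k\,v_{(k+1)}$ (revenue of the uniform $(k+1)$-st price auction). Then $\mathrm{Var}[R^D(\bm v)] \le \mathrm{Var}[R^U(\bm v)]$.
   Context: Setting: $n$ risk-neutral unit-demand bidders and $k$ identical items. The efficient allocation rule gives one item to each of the $k$ bidders with the highest values (ties, a probability-zero event, broken by any fixed rule). *)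

(* Defs.v *)
From HB Require Import structures.
From mathcomp Require Import all_boot all_order all_algebra.
From mathcomp Require Import all_classical all_reals all_analysis.
Set Implicit Arguments. Unset Strict Implicit. Unset Printing Implicit Defensive.
Import Order.TTheory GRing.Theory Num.Theory.
Local Open Scope classical_set_scope.
Local Open Scope ring_scope.

(* j-th highest value (0-indexed: j = 0 is the maximum) of a profile x. *)
Definition ord_stat {R : realType} {n : nat} (x : 'I_n -> R) (j : nat) : R :=
  nth 0 (sort (fun a b => b <= a) [seq x i | i <- enum 'I_n]) j.

Definition alloc {R : realType} {n : nat} (k : nat) (x : 'I_n -> R) (i : 'I_n) : bool :=
  (#|[set j : 'I_n | ((x i < x j)%R || ((x j == x i) && (j < i)%N))]| < k)%N.

Definition upd {T} {R : realType} {n : nat} (X : 'I_n -> T -> R) (w : T) (i : 'I_n) (v : R)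
  : 'I_n -> R := fun j => if j == i then v else X j w.

(* Mutual independence of the family X (product rule over all coordinates;
   coordinates outside a subfamily can take B j = setT). *)
Definition mutually_independent {d} {T : measurableType d} {R : realType}
  (P : probability T R) {n : nat} (X : 'I_n -> T -> R) : Prop :=
  forall B : 'I_n -> set R, (forall i, measurable (B i)) ->
    P (\big[setI/setT]_(i < n) (X i @^-1` B i)) = (\prod_(i < n) P (X i @^-1` B i))%E.

Definition has_density_on {d} {T : measurableType d} {R : realType}
  (P : probability T R) (Y : T -> R) (vbar : R) (f : R -> R) : Prop :=
  forall A : set R, measurable A ->
    P (Y @^-1` A) = (\int[lebesgue_measure]_(x in A `&` `[0%R, vbar]%classic) (f x)%:E)%E.

(* b_i(v) = E[v_(k+1) | v_i = v, A_i = 1] (with b(0) = 0, and b(v) = 0 for v <= 0):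
   conditioning on v_i = v is done by substituting v for bidder i's value (the
   other values are independent of v_i), and conditioning on the event A_i = 1
   by the ratio E[v_(k+1) 1{A_i}] / P(A_i). *)
Definition bid {d} {T : measurableType d} {R : realType}
  (P : probability T R) {n : nat} (k : nat) (X : 'I_n -> T -> R) (i : 'I_n) (v : R) : R :=
  if v <= 0 then 0 else
  fine ('E_P[fun w => ord_stat (upd X w i v) k * (alloc k (upd X w i v) i)%:R])
  / fine ('E_P[fun w => (alloc k (upd X w i v) i)%:R]).

Definition revD {d} {T : measurableType d} {R : realType}
  (P : probability T R) {n : nat} (k : nat) (X : 'I_n -> T -> R) (w : T) : R :=
  \sum_(i < n) (alloc k (fun j => X j w) i)%:R * bid P k X i (X i w).

(* Uniform (k+1)-st price revenue: k * v_(k+1)  (ord_stat index k = (k+1)-st highest). *)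
Definition revU {R : realType} {T} {n : nat} (k : nat) (X : 'I_n -> T -> R) (w : T) : R :=
  k%:R * ord_stat (fun j => X j w) k.

(* Main.v *)
Require Import Defs.
From HB Require Import structures.
From mathcomp Require Import all_boot all_order all_algebra.
From mathcomp Require Import all_classical all_reals all_analysis.
From mathcomp Require Import measurable_realfun ring.
Set Implicit Arguments. Unset Strict Implicit. Unset Printing Implicit Defensive.
Import Order.TTheory GRing.Theory Num.Theory.
Local Open Scope classical_set_scope.
Local Open Scope ring_scope.

(* Write Y = v_(k+1), a_i = A_i, b_i = b(v_i), and m = E[R^U].  Since v_i is
   independent of the other values, Fubini turns the definition of the bid into
   the orthogonality relation E[a_i (Y - b_i) g(v_i)] = 0 for every bounded g
   (bid_orthogonal).  As exactly k bidders win, sum_i a_i = k, so R^U - R^D is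
   the sum of the a_i (Y - b_i) and E[R^D] = m.  Convexity gives the pointwise bound
     (R^D - m)^2 + sum_i a_i (Y - b_i) (2 k b_i - 2 m) <= (R^U - m)^2
   (sqr_deviation_le), and the sum on the left has expectation 0. *)

(** * Order statistics and the count of winners *)

Lemma nth_sorted_ge (R : realType) (s : seq R) (k : nat) (a : R) :
  sorted (fun a b => b <= a) s -> (k < size s)%N ->
  (a <= nth 0 s k) = (k < count (fun y => (a <= y)%R) s)%N.
Proof.
have tr : transitive (fun a b : R => b <= a) by move=> y x z yx zy; exact: le_trans zy yx.
elim: s k => [//|x s IH] k xs; rewrite ltnS => ks.
have ss := path_sorted xs.
move: xs; rewrite /= (path_sortedE tr) => /andP[/allP xs _].
case: (leP a x) => [ax|xa].
  by case: k ks => [|k] ks //=; rewrite add1n ltnS IH.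
(* The list is descending, so once its head is below [a] no later entry reaches [a]: the entries at
   least [a] form an initial segment, and index [k] lies in it iff its length exceeds [k]. *)
have -> : count (fun y => a <= y) s = 0%N.
  apply/eqP; rewrite -leqn0 leqNgt -has_count; apply/hasPn => y /xs yx.
  by rewrite -ltNge (le_lt_trans yx).
case: k ks => [|k] ks /=; first by rewrite leNgt xa.
by rewrite leNgt (le_lt_trans _ xa)// xs// mem_nth.
Qed.

(** Describes the superlevel sets of the order statistic by counting alone, without the sort; this
    is what makes its measurability provable. Sorting only permutes the values, hence preserves the
    count. *)
Lemma le_ord_stat (R : realType) (n : nat) (x : 'I_n -> R) (k : nat) (a : R) :
  (k < n)%N -> (a <= ord_stat x k) = (k < \sum_(j < n) (a <= x j)%R)%N.
Proof.
move=> kn; rewrite /ord_stat nth_sorted_ge ?size_sort ?size_map ?size_enum_ord//.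
  rewrite (permP (permEl (perm_sort _ _))) count_map -sum1_count.
  rewrite big_enum_cond/= big_mkcond/=.
  by congr (_ < _)%N; apply: eq_bigr => j _; case: (a <= x j).
by apply: sort_sorted => a' b; exact: le_total.
by rewrite -enumT size_enum_ord.
Qed.

Lemma ord_stat_in (R : realType) (n : nat) (x : 'I_n -> R) (k : nat) :
  (k < n)%N -> exists j, ord_stat x k = x j.
Proof.
move=> kn; have : ord_stat x k \in [seq x i | i <- enum 'I_n].
  by rewrite -(mem_sort (fun a b => b <= a)) mem_nth// size_sort size_map size_enum_ord.
by case/mapP => j _ ->; exists j.
Qed.

Lemma ord_stat_bounded (R : realType) (n : nat) (x : 'I_n -> R) (k : nat) (M : R) :
  (k < n)%N -> (forall j, `|x j| <= M) -> `|ord_stat x k| <= M.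
Proof. by move=> /(ord_stat_in x)[j ->]. Qed.

(** A sum of Booleans replaces the cardinal, so that measurability can be checked term by term. *)
Lemma allocE (R : realType) (n k : nat) (x : 'I_n -> R) (i : 'I_n) :
  alloc k x i =
  (\sum_(j < n) ((x i < x j)%R || ((x j == x i) && (j < i)%N)) < k)%N.
Proof.
rewrite /alloc -sum1_card [in RHS](eq_bigr (fun j : 'I_n =>
  if (x i < x j)%R || ((x j == x i) && (j < i)%N) then 1%N else 0%N)); last first.
  by move=> j _; case: ifP.
rewrite -big_mkcond; congr (_ < _)%N; apply: eq_bigl => j.
by rewrite [LHS]unfold_in asboolb.
Qed.

(** Ties being broken by index, [beats] is a strict total order. The rank of a bidder, the number of
    bidders who beat him, is therefore injective into ['I_n], hence a permutation, and exactly [k]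
    ranks are below [k]. *)
Lemma sum_alloc (R : realType) (n k : nat) (x : 'I_n -> R) :
  (k <= n)%N -> \sum_(i < n) (alloc k x i)%:R = k%:R :> R.
Proof.
move=> kn.
pose beats j i := ((x i < x j)%R || ((x j == x i) && (j < i)%N)).
have irr i : ~~ beats i i by rewrite /beats ltxx ltnn andbF.
have tr i j l : beats i j -> beats j l -> beats i l.
  rewrite /beats => /orP[ij|/andP[/eqP ij ij']] /orP[jl|/andP[/eqP jl jl']].
  - by rewrite (lt_trans jl ij).
  - by rewrite -jl ij.
  - by rewrite ij jl.
  - by rewrite ij jl eqxx (ltn_trans ij' jl') orbT.
have tot i j : i != j -> beats i j || beats j i.
  rewrite /beats neq_ltn; case: (ltgtP (x i) (x j)) => //= _ /orP[] ->; by rewrite ?orbT.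
pose S i := finset (beats^~ i).
have Slt i : (#|S i| < n)%N.
  rewrite -[X in (_ < X)%N]card_ord -finset.cardsT; apply: proper_card.
  apply/properP; split; first exact: finset.subsetT.
  by exists i; rewrite ?inE /=.
(* By transitivity whoever beats [i] also beats [j], and [i] itself is one more. *)
have Smono i j : beats i j -> (#|S i| < #|S j|)%N.
  move=> ij; apply: proper_card; apply/properP; split.
    by apply/fintype.subsetP => l; rewrite !inE => /tr; apply.
  by exists i; rewrite !inE.
pose r i := Ordinal (Slt i).
have rinj : injective r.
  move=> i j /(congr1 val)/= ij; apply/eqP; apply: contraT => /tot /orP[]/Smono.
    by rewrite ij ltnn.
  by rewrite ij ltnn.
rewrite -natr_sum; congr (_%:R).
rewrite (eq_bigr (fun i => (r i < k)%N : nat)); last first.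
  move=> i _; rewrite allocE /= /S -sum1dep_card [in RHS]big_mkcond.
  by congr ((_ < _)%N : nat); apply: eq_bigr => j _; rewrite /beats; case: ifP.
transitivity (\sum_(i < n) (i < k)%N)%N; first by rewrite [RHS](reindex_inj rinj).
rewrite (eq_bigr (fun i : 'I_n => if (i < k)%N then 1%N else 0%N)); last by move=> i _; case: ltnP.
rewrite -big_mkcond/= -(big_ord_widen _ (fun=> 1%N))//.
by rewrite sum1_card card_ord.
Qed.

(** * Measurability of order statistics and of the allocation *)

Lemma measurable_fun_from_bool d (Z : measurableType d) (g : bool -> Z) :
  measurable_fun setT g.
Proof. by move=> _ B _. Qed.

Lemma measurable_sum_bool d (Z : measurableType d) (I : Type) (s : seq I)
    (B : I -> Z -> bool) : (forall j, measurable_fun setT (B j)) ->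
  measurable_fun setT (fun z => \sum_(j <- s) B j z)%N.
Proof.
move=> mB; elim: s => [|j s IH].
  by under eq_fun do rewrite big_nil; exact: measurable_cst.
under eq_fun do rewrite big_cons.
apply: measurable_fun_addn => //.
exact: (measurableT_comp (measurable_fun_from_bool nat_of_bool)).
Qed.

Lemma measurable_ord_stat d (Z : measurableType d) (R : realType) (n k : nat)
    (x : Z -> 'I_n -> R) : (k < n)%N ->
  (forall j, measurable_fun setT (x ^~ j)) ->
  measurable_fun setT (fun z => ord_stat (x z) k).
Proof.
(* The closed rays [[a, +oo[] generate the Borel sets, and their preimages are given by
   [le_ord_stat]. *)
move=> kn mx; apply: (measurability _ (RGenCInfty.measurableE R)).
move=> _ [_ [a ->] <-]; rewrite setTI.
have -> : (fun z => ord_stat (x z) k) @^-1` `[a, +oo[ =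
   (fun z => (k < \sum_(j < n) (a <= x z j)%R)%N) @^-1` [set true].
  by apply/seteqP; split => z /=; rewrite in_itv/= andbT le_ord_stat.
rewrite -[X in measurable X]setTI.
have : measurable_fun setT (fun z => (k < \sum_(j < n) (a <= x z j)%R)%N).
  apply: measurable_fun_ltn; first exact: measurable_cst.
  apply: measurable_sum_bool => j; apply: measurable_fun_ler => //.
by move=> /(_ measurableT [set true]); apply.
Qed.

Lemma measurable_alloc d (Z : measurableType d) (R : realType) (n k : nat)
    (x : Z -> 'I_n -> R) (i : 'I_n) :
  (forall j, measurable_fun setT (x ^~ j)) ->
  measurable_fun setT (fun z => alloc k (x z) i).
Proof.
move=> mx; under eq_fun do rewrite allocE.
apply: measurable_fun_ltn; last exact: measurable_cst.
apply: measurable_sum_bool => j; apply: measurable_or.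
  exact: measurable_fun_ltr.
apply: measurable_and; last exact: measurable_cst.
exact: measurable_fun_eqr.
Qed.

(** * Fubini's theorem for a pair of independent random variables *)

Definition independent2 d d1 d2 (T : measurableType d) (T1 : measurableType d1)
    (T2 : measurableType d2) (R : realType) (P : probability T R)
    (U : T -> T1) (V : T -> T2) : Prop :=
  forall A B, measurable A -> measurable B ->
    P (U @^-1` A `&` V @^-1` B) = (P (U @^-1` A) * P (V @^-1` B))%E.

Section fubini_independent.
Context d d1 d2 (T : measurableType d) (T1 : measurableType d1)
  (T2 : measurableType d2) (R : realType) (P : probability T R).
Variables (U : {RV P >-> T1}) (V : {RV P >-> T2}) (h : T1 * T2 -> \bar R).
Hypothesis indep : independent2 P U V.
Hypothesis mh : measurable_fun setT h.
Hypothesis ih : P.-integrable setT (fun w => h (U w, V w)).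

Let mUV : measurable_fun setT (fun w => (U w, V w)).
Proof. exact: measurable_fun_pair. Qed.

Let UV : {RV P >-> (T1 * T2)%type} := mfun_Sub (mem_set mUV).

(** Independence is the agreement of the two measures on rectangles, and the product measure is
    determined by its values there. *)
Let joint_law (A : set (T1 * T2)) : measurable A ->
  (distribution P U \x distribution P V)%E A = distribution P UV A.
Proof.
apply: product_measure_unique => {}A B mA mB; exact: indep.
Qed.

Let ih_prod : (distribution P U \x distribution P V)%E.-integrable setT h.
Proof.
have : (distribution P UV).-integrable setT h.
  by apply: integrable_pushforward => //.
move=> /integrableP[_ hfin]; apply/integrableP; split => //.
rewrite (eq_measure_integral (distribution P UV))//.
by move=> A mA _; exact: joint_law.
Qed.

Let mh_section x : measurable_fun setT (fun y => h (x, y)).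
Proof.
by apply: (measurableT_comp mh); exact: measurable_fun_pair.
Qed.

(** Integrability at every [x], and not only at almost every one, lets the inner integral be written
    everywhere as an integral against the law of [V]. Used to show that the bid is measurable in the
    value. *)
Lemma fubini_independent_measurable : (forall x, P.-integrable setT (fun w => h (x, V w))) ->
  measurable_fun setT (fun x => \int[P]_w h (x, V w))%E.
Proof.
move=> ihx; rewrite (_ : (fun _ => _) = fubini_F (distribution P V) h).
  exact: (measurable_fubini_F ih_prod).
apply/funext => x; rewrite /fubini_F integral_distribution; [by []|exact: mh_section|exact: ihx].
Qed.

(** Push forward to the joint law, which is the product of the marginal laws, apply Fubini there,
    and pull each integral back to [P]. *)
Lemma fubini_independent : (forall x, P.-integrable setT (fun w => h (x, V w))) ->
  (\int[P]_w h (U w, V w) = \int[P]_w \int[P]_w' h (U w, V w'))%E.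
Proof.
move=> ihx; transitivity (\int[distribution P UV]_z h z)%E.
  by rewrite integral_distribution.
rewrite (eq_measure_integral (distribution P U \x distribution P V)%E); last first.
  by move=> A mA _; apply/esym; exact: joint_law.
rewrite -integral12_prod_meas1//.
have FE x : fubini_F (distribution P V) h x = (\int[P]_w h (x, V w))%E.
  by rewrite /fubini_F integral_distribution; [by []|exact: mh_section|exact: ihx].
rewrite integral_distribution.
- by apply: eq_integral => w _; rewrite /= FE.
- exact: (measurable_fubini_F ih_prod).
have /integrableP[mF Ffin] := integrable_fubini_F ih_prod.
apply/integrableP; split; first exact: measurableT_comp.
rewrite -(ge0_integral_distribution (P := P) U (f := fun x => `|fubini_F (distribution P V) h x|%E))//.
exact: measurableT_comp.
Qed.

End fubini_independent.

Lemma integrable_ae_bounded d (T : measurableType d) (R : realType)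
    (P : probability T R) (g : T -> R) (M : R) :
  measurable_fun setT g -> {ae P, forall w, `|g w| <= M} ->
  P.-integrable setT (EFin \o g).
Proof.
move=> mg gM; apply/integrableP; split; first exact/measurable_EFinP.
have iM := finite_measure_integrable_cst P `|M| (@measurableT _ T).
apply: le_lt_trans (integrable_lty measurableT iM).
apply: ae_ge0_le_integral => //.
- by apply: measurableT_comp => //; exact/measurable_EFinP.
- by move=> w _; rewrite lee_fin.
- exact/measurable_EFinP.
- by apply: filterS gM => w gM _; rewrite lee_fin (le_trans gM)// ler_norm.
Qed.

Lemma ae_forall_fin d (T : measurableType d) (R : realType)
    (P : probability T R) (I : finType) (Q : I -> T -> Prop) :
  (forall i, {ae P, forall w, Q i w}) -> {ae P, forall w, forall i, Q i w}.
Proof. by move=> H; apply: filter_forall. Qed.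

(** * Independence of one value from the profile of the others *)

Section tuple_boxes.
Context (R : realType) (n : nat).

Definition box (B : 'I_n -> set R) : set (n.-tuple R) :=
  [set t | forall j, B j (tnth t j)].

Definition boxes : set (set (n.-tuple R)) :=
  [set A | exists2 B : 'I_n -> set R, (forall j, measurable (B j)) & A = box B].

Lemma boxes_setI : setI_closed boxes.
Proof.
move=> _ _ [B mB ->] [C mC ->]; exists (fun j => B j `&` C j).
  by move=> j; exact: measurableI.
apply/seteqP; split => t /=; first by move=> [tB tC] j; split; [exact: tB|exact: tC].
by move=> tBC; split=> j; case: (tBC j).
Qed.

Lemma measurable_box (B : 'I_n -> set R) :
  (forall j, measurable (B j)) -> measurable (box B).
Proof.
move=> mB; rewrite (_ : box B = \big[setI/setT]_(j < n) (fun t => tnth t j) @^-1` B j).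
  apply: bigsetI_measurable => j _; rewrite -[X in measurable X]setTI.
  exact: measurable_tnth.
rewrite -bigcap_seq; apply/seteqP; split => t /=; first by move=> Bt j _; exact: Bt.
by move=> Bt j; apply: Bt; rewrite /= mem_index_enum.
Qed.

(** A cylinder over one coordinate is a box whose other sides are [setT], and a box is a finite
    intersection of cylinders. With [boxes_setI], boxes form a generating pi-system. *)
Lemma measurable_tuple_boxes : measurable = <<s boxes >>.
Proof.
apply/seteqP; split; last first.
  apply: smallest_sub; first exact: sigma_algebra_measurable.
  by move=> _ [B mB ->]; exact: measurable_box.
apply: smallest_sub; first exact: smallest_sigma_algebra.
rewrite -bigcup_seq => A [/= i _ [B mB <-]]; rewrite setTI.
apply: sub_sigma_algebra; exists (fun j => if j == i then B else setT).
  by move=> j; case: ifP.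
apply/seteqP; split => t /=.
  by move=> Bt j; case: eqP => [->|].
by move=> /(_ i); rewrite eqxx.
Qed.

End tuple_boxes.

(* The profile of the competitors of bidder i is encoded as a full n-tuple with
   entry 0 at position i. *)
Section others.
Context d (T : measurableType d) (R : realType) (P : probability T R)
  (n : nat) (X : 'I_n -> T -> R).
Hypothesis mX : forall i, measurable_fun setT (X i).
Hypothesis indepX : mutually_independent P X.

Definition others (i : 'I_n) (w : T) : n.-tuple R := [tuple upd X w i 0 j | j < n].

Lemma measurable_others i : measurable_fun setT (others i).
Proof.
apply/measurable_fun_tnthP => j.
rewrite (_ : _ \o _ = fun w => if j == i then 0 else X j w); last first.
  by apply/funext => w /=; rewrite tnth_mktuple.
by case: (j == i).
Qed.

(** Coordinate [i] of [others] is constantly 0, so under [B i 0] side [i] imposes nothing and may be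
    widened to [setT]. *)
Lemma others_box i (B : 'I_n -> set R) : B i 0 ->
  others i @^-1` box B = \big[setI/setT]_(j < n) (X j @^-1` (if j == i then setT else B j)).
Proof.
move=> Bi0; rewrite -bigcap_seq; apply/seteqP; split => w /= Bw j.
  move=> _; have := Bw j; rewrite tnth_mktuple /upd.
  by case: (j == i).
rewrite tnth_mktuple /upd; have := Bw j; rewrite /= mem_index_enum => /(_ isT).
by case: eqP => [->|].
Qed.

(** Dynkin's pi-lambda argument in the second set: the product rule holds on boxes by mutual
    independence, and passes to complements and countable disjoint unions. *)
Lemma independent_others i : independent2 P (X i) (others i).
Proof.
move=> A D mA; rewrite measurable_tuple_boxes.
have mC : measurable (X i @^-1` A) by rewrite -[_ @^-1` _]setTI; exact: mX.
have mV B : measurable B -> measurable (others i @^-1` B).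
  by move=> mB; rewrite -[_ @^-1` _]setTI; exact: measurable_others.
move: D; apply: (dynkin_induction (measurable_tuple_boxes R n)).
- exact: boxes_setI.
- by rewrite preimage_setT setIT probability_setT mule1.
(* If side [i] misses the placeholder 0, the preimage of the box is empty and both sides vanish. *)
- move=> _ [B mB ->]; have [Bi0|Bi0] := pselect (B i 0); last first.
    rewrite (_ : others i @^-1` _ = set0) ?setI0 ?measure0 ?mule0//.
    by apply/seteqP; split => w //= /(_ i); rewrite tnth_mktuple /upd eqxx.
  rewrite others_box// indepX; last by move=> j; case: ifP.
  (* Side [i] is free, so the event on [X i] takes its place and mutual independence applies once
     more. *)
  rewrite (_ : _ `&` _ = \big[setI/setT]_(j < n) (X j @^-1` (if j == i then A else B j))); last first.
    rewrite -!bigcap_seq; apply/seteqP; split => w /=.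
      by move=> [Aw Bw] j jn; have := Bw j jn; case: eqP => [->|].
    move=> ABw; split; first by have := ABw i; rewrite /= mem_index_enum eqxx; exact.
    by move=> j jn; have := ABw j jn; case: eqP.
  rewrite indepX; last by move=> j; case: ifP.
  rewrite (bigD1 i)//= [in RHS](bigD1 i)//= eqxx preimage_setT probability_setT mul1e.
  by congr (_ * _)%E; apply: eq_bigr => j /negPf ->.
- move=> B mB IH; have mVB := mV B mB.
  rewrite (_ : others i @^-1` (~` B) = ~` (others i @^-1` B))// -setDE.
  transitivity (P (X i @^-1` A) - P (X i @^-1` A `&` others i @^-1` B))%E.
    by apply: measureD => //; rewrite -ge0_fin_numE// fin_num_measure.
  rewrite IH probability_setC// muleBr ?mule1 ?fin_num_measure//.
- move=> F mF tF IH.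
  have tV : trivIset setT (fun m => others i @^-1` F m).
    apply/trivIsetP => a b _ _ ab; rewrite -preimage_setI.
    by move/trivIsetP : tF => /(_ a b I I ab) ->; rewrite preimage_set0.
  rewrite preimage_bigcup setI_bigcupr.
  rewrite !measure_bigcup//.
  + rewrite -[P (X i @^-1` A)]fineK ?fin_num_measure// -nneseriesZl//.
    by rewrite fineK ?fin_num_measure//; apply: eq_eseriesr => m _; exact: IH.
  + by move=> m _; exact: mV.
  + by move=> m _; apply: measurableI => //; exact: mV.
  + by exact: trivIset_setIl.
Qed.

End others.

(** Outside []0, vbar]] the interval of integration retains at most the point 0, a Lebesgue-null
    set. Strict positivity matters because [bid] is set to 0 by convention at nonpositive values. *)
Lemma ae_density_support d (T : measurableType d) (R : realType) (P : probability T R)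
    (Y : T -> R) (vbar : R) (f : R -> R) : measurable_fun setT Y ->
  has_density_on P Y vbar f -> {ae P, forall w, 0 < Y w <= vbar}.
Proof.
move=> mY dY; exists (Y @^-1` (~` `]0, vbar])); split.
- by rewrite -[_ @^-1` _]setTI; apply: mY => //; exact: measurableC.
- rewrite dY; last exact: measurableC.
  apply: (integral_Sset1 0) => x [] /=; rewrite !in_itv/= => nx /andP[x0 xv].
  apply/eqP; rewrite eq_le x0 andbT leNgt; apply/negP => x1.
  by apply: nx; rewrite x1.
- by move=> w /=; rewrite in_itv.
Qed.

Lemma integrable_expectationE d (T : measurableType d) (R : realType)
    (P : probability T R) (g : T -> R) :
  P.-integrable setT (EFin \o g) -> (fine 'E_P[g])%:E = (\int[P]_w (g w)%:E)%E.
Proof.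
by move=> ig; rewrite unlock fineK//; exact: (integrable_fin_num measurableT ig).
Qed.

Lemma measurable_alloc_natr d (Z : measurableType d) (R : realType) (n k : nat)
    (x : Z -> 'I_n -> R) (i : 'I_n) :
  (forall j, measurable_fun setT (x ^~ j)) ->
  measurable_fun setT (fun z => (alloc k (x z) i)%:R : R).
Proof.
move=> mx; pose g (b : bool) : R := b%:R.
exact: (measurableT_comp (measurable_fun_from_bool g) (measurable_alloc k i mx)).
Qed.

(** * Bounds, measurability and orthogonality of the bids *)

Section bids.
Context d (T : measurableType d) (R : realType) (P : probability T R)
  (n k : nat) (vbar : R) (X : 'I_n -> T -> R).
Hypothesis kn : (k < n)%N.
Hypothesis mX : forall i, measurable_fun setT (X i).
Hypothesis indepX : mutually_independent P X.
Hypothesis X_vbar : {ae P, forall w, forall j, 0 < X j w <= vbar}.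

Let won i v w : R := (alloc k (upd X w i v) i)%:R.
Let price i v w : R := ord_stat (upd X w i v) k.

Let mupd i v j : measurable_fun setT (fun w => upd X w i v j).
Proof. by rewrite /upd; case: (j == i). Qed.

Let mwon i v : measurable_fun setT (won i v).
Proof.
exact: measurable_alloc_natr.
Qed.

Let mprice i v : measurable_fun setT (price i v).
Proof. exact: measurable_ord_stat. Qed.

Lemma price_bounded i v :
  {ae P, forall w, `|ord_stat (upd X w i v) k| <= Num.max `|v| `|vbar|}.
Proof.
apply: filterS X_vbar => w Xw; apply: ord_stat_bounded => // j.
rewrite /upd le_max; case: eqP => _; first by rewrite lexx.
have /andP[X0 Xv] := Xw j.
by rewrite gtr0_norm// (le_trans Xv (ler_norm _)) orbT.
Qed.

Let won01 i v w : `|won i v w| <= 1.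
Proof. by rewrite /won; case: alloc; rewrite ?normr1 ?normr0. Qed.

Let iwon i v : P.-integrable setT (EFin \o won i v).
Proof. by apply: (integrable_ae_bounded (M := 1)) => //; apply: nearW. Qed.

Let ipricewon i v : P.-integrable setT (EFin \o (fun w => price i v w * won i v w)).
Proof.
apply: (integrable_ae_bounded (M := Num.max `|v| `|vbar|)).
  exact: measurable_funM.
apply: filterS (price_bounded i v) => w pw.
by rewrite normrM (le_trans _ pw)// ler_piMr.
Qed.

Let EW i v := fine 'E_P[won i v].
Let EPW i v := fine 'E_P[fun w => price i v w * won i v w].

(** Besides bounding the bid, this forces the numerator of the bid to vanish whenever the winning
    probability does. *)
Let EPW_bounded i v : `|EPW i v| <= Num.max `|v| `|vbar| * EW i v.
Proof.
rewrite -lee_fin EFinM -[(`|_|)%:E]/(`|(_)%:E|)%E !integrable_expectationE//.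
rewrite -integralZl//; last exact: iwon.
apply: le_trans (le_abse_integral _ _ _) _ => //.
  by apply/measurable_EFinP; exact: measurable_funM.
apply: ae_ge0_le_integral => //.
- by apply: measurableT_comp => //; apply/measurable_EFinP; exact: measurable_funM.
- by move=> w _; rewrite -EFinM lee_fin mulr_ge0// /won le_max normr_ge0.
- apply/measurable_EFinP; exact: measurable_funM.
- apply: filterS (price_bounded i v) => w pw _.
  by rewrite -EFinM lee_fin normrM (ger0_norm (x := won i v w))// ler_wpM2r.
Qed.

Let bidE i v : 0 < v -> bid P k X i v = EPW i v / EW i v.
Proof. by rewrite /bid leNgt => ->. Qed.

Let EW_ge0 i v : 0 <= EW i v.
Proof. by apply: fine_ge0; apply: expectation_ge0 => w; rewrite /won. Qed.

Lemma bid_bounded i v : `|bid P k X i v| <= Num.max `|v| `|vbar|.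
Proof.
rewrite /bid; case: ifPn => [_|v0]; first by rewrite normr0 le_max normr_ge0.
rewrite -ltNge in v0; rewrite -/(EPW i v) -/(EW i v) normrM normfV.
have [->|W0] := eqVneq (EW i v) 0; first by rewrite normr0 invr0 mulr0 le_max normr_ge0.
have Wp : 0 < EW i v by rewrite lt_def W0 EW_ge0.
by rewrite (gtr0_norm Wp) ler_pdivrMr.
Qed.

(** Holds even when the winning probability is 0: [EPW_bounded] then makes the right side 0 too, so
    no positivity of [EW] has to be proved. *)
Let bid_mul i v : 0 < v -> bid P k X i v * EW i v = EPW i v.
Proof.
move=> v0; rewrite bidE//; have [W0|W0] := eqVneq (EW i v) 0; last by rewrite divfK.
rewrite W0 mulr0; apply/esym/eqP; rewrite -normr_le0.
by have := EPW_bounded i v; rewrite W0 mulr0.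
Qed.

(** Overwrites the placeholder at [i], which exhibits the profile as a function of the independent
    pair [X i] and [others X i]. *)
Let joint i (v : R) (t : n.-tuple R) : 'I_n -> R :=
  fun j => if j == i then v else tnth t j.

Let joint_others i v w : joint i v (others X i w) = upd X w i v.
Proof.
by apply/funext => j; rewrite /joint tnth_mktuple /upd; case: (j == i).
Qed.

Let mjoint i j : measurable_fun setT (fun z : R * n.-tuple R => joint i z.1 z.2 j).
Proof.
rewrite /joint; case: (j == i).
  exact: measurable_fst.
exact: (measurableT_comp (@measurable_tnth _ R n j) measurable_snd).
Qed.

Let mwon_joint i : measurable_fun setT
  (fun z : R * n.-tuple R => (alloc k (joint i z.1 z.2) i)%:R : R).
Proof.
exact: measurable_alloc_natr.
Qed.

Let mprice_joint i : measurable_fun setT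
  (fun z : R * n.-tuple R => ord_stat (joint i z.1 z.2) k).
Proof. exact: measurable_ord_stat. Qed.

Let U i : {RV P >-> R} := mfun_Sub (mem_set (mX i)).
Let V i : {RV P >-> n.-tuple R} := mfun_Sub (mem_set (measurable_others mX i)).

Lemma upd_id i w : upd X w i (X i w) = fun j => X j w.
Proof. by apply/funext => j; rewrite /upd; case: eqP => [->|]. Qed.

(** Stated for a general [F] to serve both the numerator and the denominator of the bid. *)
Let measurable_mean i (F : ('I_n -> R) -> R) :
  measurable_fun setT (fun z : R * n.-tuple R => F (joint i z.1 z.2)) ->
  P.-integrable setT (EFin \o (fun w => F (fun j => X j w))) ->
  (forall v, P.-integrable setT (EFin \o (fun w => F (upd X w i v)))) ->
  measurable_fun setT (fun v => fine 'E_P[fun w => F (upd X w i v)]).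
Proof.
move=> mF iF iFv; pose h (z : R * n.-tuple R) := (F (joint i z.1 z.2))%:E.
have hE v w : h (v, V i w) = (F (upd X w i v))%:E by rewrite /h/= joint_others.
have H : measurable_fun setT (fun v => \int[P]_w h (v, V i w))%E.
  apply: (fubini_independent_measurable (U := U i)).
  - exact: independent_others.
  - exact/measurable_EFinP.
  - by under eq_fun do rewrite hE upd_id; exact: iF.
  - by move=> v; under eq_fun do rewrite hE; exact: iFv.
apply: (measurableT_comp (@fine_measurable _ _ measurableT)).
apply: eq_measurable_fun H => v _; rewrite unlock.
by apply: eq_integral => w _; rewrite hE.
Qed.

Lemma price_X_bounded :
  {ae P, forall w, `|ord_stat (fun j => X j w) k| <= `|vbar|}.
Proof.
apply: filterS X_vbar => w Xw; apply: ord_stat_bounded => // j.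
by have /andP[X0 Xv] := Xw j; rewrite gtr0_norm// (le_trans Xv (ler_norm _)).
Qed.

Lemma measurable_bid i : measurable_fun setT (bid P k X i).
Proof.
apply: measurable_fun_ifT; [exact: measurable_fun_ler| exact: measurable_cst|].
apply: measurable_funM.
  apply: (measurable_mean (F := fun x => ord_stat x k * (alloc k x i)%:R)).
  - exact: measurable_funM.
  - apply: (integrable_ae_bounded (M := `|vbar|)).
      by apply: measurable_funM; [exact: measurable_ord_stat|exact: measurable_alloc_natr].
    apply: filterS price_X_bounded => w pw.
    rewrite normrM (le_trans _ pw)// ler_piMr//.
    by case: alloc; rewrite ?normr1 ?normr0.
  - by move=> v; exact: ipricewon.
(* On nonnegative reals, 0 included, inversion coincides with the power -1, a measurable
   function. *)
rewrite (_ : (fun _ => _) = fun v => EW i v `^ (-1)); last first.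
  by apply/funext => v; rewrite powR_inv1// EW_ge0.
apply: (measurableT_comp (measurable_powR _)).
apply: (measurable_mean (F := fun x => (alloc k x i)%:R)) => //.
- apply: (integrable_ae_bounded (M := 1)); first exact: measurable_alloc_natr.
  by apply: nearW => w; case: alloc; rewrite ?normr1 ?normr0.
- by move=> v; exact: iwon.
Qed.

Lemma bid_X_bounded i : {ae P, forall w, `|bid P k X i (X i w)| <= `|vbar|}.
Proof.
apply: filterS X_vbar => w Xw; apply: le_trans (bid_bounded i (X i w)) _.
have /andP[X0 Xv] := Xw i.
by rewrite ge_max lexx andbT gtr0_norm// (le_trans Xv (ler_norm _)).
Qed.

(** Once the value of bidder [i] is frozen at [v], the bid and [g v] are constants, and the mean
    over the other values is [g v * (EPW i v - bid P k X i v * EW i v)], which is 0 by [bid_mul]. *)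
Lemma bid_orthogonal i (g : R -> R) (C : R) : measurable_fun setT g ->
  {ae P, forall w, `|g (X i w)| <= C} ->
  (\int[P]_w ((alloc k (fun j => X j w) i)%:R *
     (ord_stat (fun j => X j w) k - bid P k X i (X i w)) * g (X i w))%:E = 0)%E.
Proof.
move=> mg gC.
pose h (z : R * n.-tuple R) := ((alloc k (joint i z.1 z.2) i)%:R *
  (ord_stat (joint i z.1 z.2) k - bid P k X i z.1) * g z.1)%:E.
have hE v w : h (v, V i w) =
    (won i v w * (price i v w - bid P k X i v) * g v)%:E.
  by rewrite /h/= joint_others.
have mb := measurable_bid i.
have mh : measurable_fun setT h.
  apply/measurable_EFinP; apply: measurable_funM; last first.
    exact: (measurableT_comp mg measurable_fst).
  apply: measurable_funM => //; apply: measurable_funB => //.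
  exact: (measurableT_comp mb measurable_fst).
have ihv v : P.-integrable setT (fun w => h (v, V i w)).
  under eq_fun do rewrite hE.
  apply: (integrable_ae_bounded (g := fun w => _) (M := (Num.max `|v| `|vbar| + Num.max `|v| `|vbar|) * `|g v|)).
    apply: measurable_funM => //; apply: measurable_funM => //.
    exact: measurable_funB.
  apply: filterS (price_bounded i v) => w pw; rewrite !normrM ler_wpM2r//.
  rewrite (le_trans (ler_piMl _ (won01 i v w)))//.
  by rewrite (le_trans (ler_normB _ _))// lerD// bid_bounded.
have ih : P.-integrable setT (fun w => h (U i w, V i w)).
  apply: (integrable_ae_bounded (M := (`|vbar| + `|vbar|) * `|C|)).
    by apply/measurable_EFinP; exact: (measurableT_comp mh (measurable_fun_pair _ _)).
  move: price_X_bounded (bid_X_bounded i) gC.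
  apply: filterS3 => w pw bw gw.
  rewrite /= joint_others upd_id !normrM ler_pM// ?(le_trans gw)// ?ler_norm//.
  rewrite (le_trans (ler_piMl _ _))//.
    by case: alloc; rewrite ?normr1 ?normr0.
  by rewrite (le_trans (ler_normB _ _))// lerD.
have inner v : 0 < v -> (\int[P]_w h (v, V i w) = 0)%E.
  move=> v0.
  transitivity (\int[P]_w ((g v)%:E * ((price i v w * won i v w)%:E - (bid P k X i v)%:E * (won i v w)%:E)))%E.
    apply: eq_integral => w _; rewrite hE.
    transitivity (g v * (price i v w * won i v w - bid P k X i v * won i v w))%:E.
      by congr (_%:E); ring.
    by [].
  have ibw := integrableZl measurableT (bid P k X i v) (iwon i v).
  rewrite integralZl//; last by apply: integrableB => //; exact: ipricewon.
  rewrite integralB//; last exact: ipricewon. rewrite (integralZl measurableT (iwon i v)).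
  rewrite -(integrable_expectationE (iwon i v)) -(integrable_expectationE (ipricewon i v)).
  by rewrite -EFinM -/(EW i v) bid_mul// -/(EPW i v) subrr mulr0.
transitivity (\int[P]_w h (U i w, V i w))%E.
  by apply: eq_integral => w _; rewrite /h /= joint_others upd_id.
rewrite fubini_independent//; last exact: independent_others.
(* The inner integral is known to vanish only for positive values, which occur almost surely. *)
rewrite (ae_eq_integral (cst 0%E))//.
- by rewrite integral_cst// mul0e.
- apply: (measurableT_comp (f := fun v => \int[P]_w h (v, V i w))%E) => //.
  by apply: (fubini_independent_measurable (U := U i)) => //; exact: independent_others.
- by apply: filterS X_vbar => w Xw _; rewrite inner//; case/andP: (Xw i).
Qed.

End bids.

(* With [D = \sum_i a i * b i] and [\sum_i a i = k], the right side minus the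
   left side is [k * \sum_i a i * (Y - b i) ^ 2 + k * \sum_i a i * (b i - D / k) ^ 2]. *)
Lemma sqr_deviation_le (R : realFieldType) (n : nat) (a b : 'I_n -> R) (k Y m : R) :
  0 < k -> (forall i, 0 <= a i) -> \sum_(i < n) a i = k ->
  (\sum_(i < n) a i * b i - m) ^+ 2 +
    \sum_(i < n) a i * (Y - b i) * (2 * k * b i - 2 * m) <= (k * Y - m) ^+ 2.
Proof.
move=> k0 a0 ak; set D := \sum_(i < n) a i * b i.
pose Q := \sum_(i < n) a i * b i ^+ 2.
(* A weighted sum of quadratics in [b i] depends only on [k], [D] and [Q], so the claimed identity
   becomes one between rational expressions in finitely many scalars. *)
have quad (p q r : R) :
    \sum_(i < n) a i * (p + q * b i + r * b i ^+ 2) = p * k + q * D + r * Q.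
  rewrite -[in RHS]ak /D /Q !mulr_sumr -!big_split /=.
  by apply: eq_bigr => i _; ring.
have E1 : \sum_(i < n) a i * (Y - b i) * (2 * k * b i - 2 * m) =
    - (2 * m * Y) * k + (2 * k * Y + 2 * m) * D + (- (2 * k)) * Q.
  by rewrite -quad; apply: eq_bigr => i _; ring.
have E2 : \sum_(i < n) a i * (Y - b i) ^+ 2 = Y ^+ 2 * k + (- (2 * Y)) * D + 1 * Q.
  by rewrite -quad; apply: eq_bigr => i _; ring.
have E3 : \sum_(i < n) a i * (b i - D / k) ^+ 2 =
    (D / k) ^+ 2 * k + (- (2 * (D / k))) * D + 1 * Q.
  by rewrite -quad; apply: eq_bigr => i _; ring.
have H1 : 0 <= \sum_(i < n) a i * (Y - b i) ^+ 2.
  by apply: sumr_ge0 => i _; rewrite mulr_ge0// sqr_ge0.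
have H2 : 0 <= \sum_(i < n) a i * (b i - D / k) ^+ 2.
  by apply: sumr_ge0 => i _; rewrite mulr_ge0// sqr_ge0.
rewrite E1 -subr_ge0.
rewrite (_ : _ - _ = k * (\sum_(i < n) a i * (Y - b i) ^+ 2) +
  k * (\sum_(i < n) a i * (b i - D / k) ^+ 2)); last first.
  by rewrite E2 E3; field; rewrite gt_eqF.
by rewrite addr_ge0// mulr_ge0// ltW.
Qed.

(** * Comparison of the two variances *)

Unset Implicit Arguments. Set Strict Implicit. Set Printing Implicit Defensive.

Theorem mainTheorem15 (d : measure_display) (T : measurableType d) (R : realType)
  (P : probability T R) (n k : nat) (vbar : R) (f : R -> R) (X : 'I_n -> T -> R) :
  (1 <= k)%N -> (k < n)%N ->
  measurable_fun setT f ->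
  (forall x, 0 <= x <= vbar -> 0 < f x) ->
  (forall i, measurable_fun setT (X i)) ->
  mutually_independent P X ->
  (forall i, has_density_on P (X i) vbar f) ->
  ('V_P[revD P k X] <= 'V_P[revU k X])%E.
Proof.
move=> k1 kn _ _ mX indepX dX.
have X_vbar : {ae P, forall w, forall j, 0 < X j w <= vbar}.
  by apply: ae_forall_fin => j; exact: ae_density_support (mX j) (dX j).
pose Y w := ord_stat (fun j => X j w) k.
pose a i w : R := (alloc k (fun j => X j w) i)%:R.
pose b i w := bid P k X i (X i w).
have sum_a w : \sum_(i < n) a i w = k%:R by apply: sum_alloc; exact: ltnW.
have a01 i w : 0 <= a i w <= 1 by rewrite /a; case: alloc; rewrite /= ?ler01 ?lexx.
have ma i : measurable_fun setT (a i) by exact: measurable_alloc_natr.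
have mY : measurable_fun setT Y by exact: measurable_ord_stat.
have mbid i : measurable_fun setT (bid P k X i).
  exact: (measurable_bid kn mX indepX X_vbar).
have mb i : measurable_fun setT (b i) by exact: measurableT_comp.
have bounded_all : {ae P, forall w, `|Y w| <= `|vbar| /\ forall i, `|b i w| <= `|vbar|}.
  apply: filterS2 (price_X_bounded kn X_vbar)
    (ae_forall_fin (fun i => bid_X_bounded kn mX X_vbar i)).
  by move=> w Yw bw; split.
pose D := revD P k X; pose U := revU k X.
have DE w : D w = \sum_(i < n) a i w * b i w by [].
have UE w : U w = k%:R * Y w by [].
have mD : measurable_fun setT D.
  by apply: measurable_sum => i; exact: (measurable_funM (ma i) (mb i)).
have mU : measurable_fun setT U by exact: (measurable_funM (measurable_cst _) mY).
(* The weights [a i w] sum to [k], and almost surely price and bids are at most [|vbar|] in absolute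
   value. *)
pose K : R := k%:R * `|vbar|.
have bound_all' : {ae P, forall w, `|D w| <= K /\ `|U w| <= K}.
  apply: filterS bounded_all => w [Yw bw]; split.
    rewrite DE (le_trans (ler_norm_sum _ _ _))// /K -(sum_a w) mulr_suml.
    apply: ler_sum => i _; have /andP[ai0 _] := a01 i w.
    by rewrite normrM ger0_norm// ler_wpM2l.
  by rewrite UE normrM normr_nat ler_wpM2l.
pose m := fine 'E_P[U].
(* The orthogonality relation summed over bidders, with an affine function of the bid as multiplier.
   The choice [c = 0], [e = -1] will compare the means, and [c = 2 * k], [e = - 2 * m] the
   variances. *)
pose G (c e : R) w := \sum_(i < n) a i w * (Y w - b i w) * (c * b i w + e).
have iG c e i : P.-integrable setT
    (EFin \o (fun w => a i w * (Y w - b i w) * (c * b i w + e))).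
  apply: (integrable_ae_bounded (M := (`|vbar| + `|vbar|) * (`|c| * `|vbar| + `|e|))).
    apply: measurable_funM; first by apply: measurable_funM => //; exact: measurable_funB.
    by apply: measurable_funD => //; exact: measurable_funM.
  apply: filterS bounded_all => w [Yw bw].
  have /andP[ai0 ai1] := a01 i w.
  rewrite !normrM ler_pM ?mulr_ge0//.
    have Yb : `|Y w - b i w| <= `|vbar| + `|vbar|.
      by rewrite (le_trans (ler_normB _ _))// lerD.
    by apply: le_trans (ler_piMl _ _) Yb => //; rewrite ger0_norm.
  by rewrite (le_trans (ler_normD _ _))// lerD// normrM ler_wpM2l.
have IG c e : P.-integrable setT (EFin \o G c e).
  rewrite (_ : EFin \o _ = fun w => (\sum_(i < n) (a i w * (Y w - b i w) * (c * b i w + e))%:E)%E).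
    by apply: integrable_sum => // i _; exact: iG.
  by apply/funext => w /=; rewrite /G sumEFin.
have G0 c e : (\int[P]_w (G c e w)%:E = 0)%E.
  transitivity (\int[P]_w (\sum_(i < n) (a i w * (Y w - b i w) * (c * b i w + e))%:E)%E)%E.
    by apply: eq_integral => w _; rewrite sumEFin.
  rewrite integral_sum//; last by move=> i; exact: iG.
  rewrite big1// => i _.
  apply: (bid_orthogonal kn mX indepX X_vbar (g := fun v => c * bid P k X i v + e)
    (C := `|c| * `|vbar| + `|e|)).
    by apply: measurable_funD => //; exact: measurable_funM.
  apply: filterS bounded_all => w [_ bw].
  by rewrite (le_trans (ler_normD _ _))// lerD// normrM ler_wpM2l//; exact: bw.
have iD : P.-integrable setT (EFin \o D).
  apply: (integrable_ae_bounded (M := K)) => //.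
  by apply: filterS bound_all' => w [].
have iU : P.-integrable setT (EFin \o U).
  apply: (integrable_ae_bounded (M := K)) => //.
  by apply: filterS bound_all' => w [].
have EDU : 'E_P[D]%E = 'E_P[U]%E.
  (* Since the [a i w] sum to [k], [G 0 (-1)] equals [D - U] pointwise. *)
  rewrite unlock -[RHS]adde0 -(G0 0 (-1)) -integralD//; last exact: IG.
  apply: eq_integral => w _; rewrite -EFinD; congr (_%:E).
  rewrite UE DE /G -(sum_a w) mulr_suml -big_split /=.
  by apply: eq_bigr => i _; ring.
have isq (g : T -> R) : measurable_fun setT g -> {ae P, forall w, `|g w| <= K} ->
    P.-integrable setT (EFin \o (fun w => (g w - m) ^+ 2)).
  move=> mg gK; apply: (integrable_ae_bounded (M := (K + `|m|) ^+ 2)).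
    by apply: measurable_funX; exact: measurable_funB.
  apply: filterS gK => w gw; rewrite normrX lerXn2r ?nnegrE//.
    by rewrite addr_ge0// (le_trans _ gw).
  by rewrite (le_trans (ler_normB _ _))// lerD.
have VE (g : T -> R) : fine 'E_P[g] = m -> ('V_P[g] = \int[P]_w ((g w - m) ^+ 2)%:E)%E.
  move=> gm; rewrite /variance unlock gm unlock.
  by apply: eq_integral => w _; rewrite expr2.
rewrite (VE D) ?(VE U) ?EDU//.
have isD := isq D mD (filterS (fun w => @proj1 _ _) bound_all').
have isU := isq U mU (filterS (fun w => @proj2 _ _) bound_all').
(* Adding this mean-zero term changes no integral but turns the comparison into the pointwise one of
   [sqr_deviation_le]; without it the inequality can fail pointwise. *)
rewrite -[leLHS]adde0 -(G0 (2 * k%:R) (- (2 * m))) -integralD//; [|exact: isD|exact: IG].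
apply: le_integral => //; [by apply: integrableD => //; [exact: isD|exact: IG]|exact: isU|].
move=> w _; rewrite -EFinD lee_fin DE UE.
apply: sqr_deviation_le => //; first by rewrite ltr0n.
Qed.
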